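(* Let $(\mathcal{E},\mathcal{F})$ be a regular Dirichlet form in $L^{2}(M,\mu)$. If condition $(\mathrm{wEH})$ (defined in the context) holds, then condition $(\mathrm{LG}_0)$ holds, that is: there exist four constants $\sigma,\epsilon_0,\eta,\delta\in(0,1)$ such that, for any ball $B=B(x_0,R)$ with $R\in(0,\sigma\overline R)$ and any $u\in\mathcal F'\cap L^\infty$ that is superharmonic in $B$ and non-negative globally in $M$, if $$\frac{\mu(\delta B\cap\{u<a\})}{\mu(\delta B)}\le\epsilon_0$$ for some $a>0$, then $$\operatorname{ess\,inf}_{\delta B}u\ge\eta a.$$
   Context: Metric measure space: $(M,d)$ is a locally compact separable metric space, $\mu$ a Radon measure on $M$ with full support, $B(x,r)=\{y\in M:d(x,y)<r\}$. Every ball is assumed precompact and comes with a fixed centre and radius; for $B=B(x,r)$ and $\lambda>0$, $\lambda B=B(x,\lambda r)$. $\overline R\in(0,\mathrm{diam}(M)]$ is fixed (possibly $\infty$). The map $w:M\times[0,\infty)\to[0,\infty)$ is such that $w(x,\cdot)$ is continuous, strictly increasing, $w(x,0)=0$ for each $x$, and there are constants $C_1,C_2>0$, $\beta_2\ge\beta_1>0$ with $C_1(R/r)^{\beta_1}\le w(x,R)/w(y,r)\le C_2(R/r)^{\beta_2}$ for all $0<r\le R<\infty$ and $x,y\in M$ with $d(x,y)\le R$. For $B=B(x,R)$ write $w(B)=w(x,R)$. Ess inf, ess sup are with respect to $\mu$. Dirichlet form: the form has no killing part, i.e. $\mathcal E=\mathcal E^{(L)}+\mathcal E^{(J)}$ with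 $\mathcal E^{(L)}$ strongly local and $\mathcal E^{(J)}(u,u)=\iint_{M\times M\setminus\mathrm{diag}}(u(x)-u(y))^2J(dx,dy)$, and the (symmetric) jump measure is given by a transition kernel, $J(dx,dy)=J(x,dy)\mu(dx)$. $\mathcal F'=\{v+a:v\in\mathcal F,a\in\mathbb R\}$, $\mathcal E(u+a,v+b):=\mathcal E(u,v)$ for $u,v\in\mathcal F$, $a,b\in\mathbb R$. For open $\Omega\subset M$, $\mathcal F(\Omega)$ is the closure of $\mathcal F\cap C_0(\Omega)$ in the norm $\sqrt{\mathcal E(u,u)+\|u\|_2^2}$, $C_0(\Omega)$ being the continuous functions with compact support in $\Omega$. A function $u\in\mathcal F'$ is $f$-superharmonic in $\Omega$ if $\mathcal E(u,\varphi)\ge(f,\varphi)$ for all $0\le\varphi\in\mathcal F(\Omega)$; superharmonic means $f\equiv0$. $T_{U,\Omega}(v)=\operatorname{ess\,sup}_{x\in U}\int_{\Omega^c}|v(y)|J(x,dy)$ for open $U\Subset\Omega$; $u_-=\max(0,-u)$. $(\mathrm{wEH})$: there exist $p,\delta,\sigma\in(0,1)$, $C_H\ge1$ such that for all concentric balls $B_r=B(x_0,r)\subset B_R=B(x_0,R)$ with $0<r\le\delta R$, $R<\sigma\overline R$, every $f\in L^\infty(B_R)$ and every $u\in\mathcal F'\cap L^\infty$ non-negative and $f$-superharmonic in $B_R$, $\big(\frac1{\mu(B_r)}\int_{B_r}u^pd\mu\big)^{1/p}\le C_H\big(\operatorname{ess\,inf}_{B_r}u+w(B_r)(T_{\frac34B_R,B_R}(u_-)+\|f\|_{L^\infty(B_R)})\big)$.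 *)

(* Defs.v *)
From HB Require Import structures.
From mathcomp Require Export all_boot all_order all_algebra.
From mathcomp Require Export all_classical all_reals all_analysis.
Set Implicit Arguments.
Unset Strict Implicit.
Unset Printing Implicit Defensive.

Export Order.TTheory GRing.Theory Num.Theory.
Export numFieldNormedType.Exports.

Local Open Scope classical_set_scope.
Local Open Scope ring_scope.

#[short(type="metricMeasurableType")]
HB.structure Definition MetricMeasurable d (R : realType) :=
  {M of Metric R M & Measurable d M}.

Section metric_measure_space.
Context {R : realType} {d : measure_display} {M : metricMeasurableType d R}.
Variable mu : {measure set M -> \bar R}.

Record radon_measure : Prop := {
  radon_compact : forall K : set M, compact K -> (mu K < +oo)%E;
  radon_outer : forall A : set M, measurable A ->
    mu A = ereal_inf [set mu U | U in [set U | open U /\ A `<=` U]];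
  radon_inner : forall U : set M, open U ->
    mu U = ereal_sup [set mu K | K in [set K | compact K /\ K `<=` U]] }.

Record metric_measure_space : Prop := {
  mms_borel : @measurable d M = <<s [set U : set M | open U] >>;
  mms_locally_compact : locally_compact [set: M];
  mms_separable : exists2 D : set M, countable D & dense D;
  mms_radon : radon_measure;
  mms_full_support : forall U : set M, open U -> U !=set0 -> (0 < mu U)%E;
  mms_precompact_ball : forall (x : M) (r : R), 0 < r -> precompact (ball x r) }.

Definition diameter : \bar R :=
  ereal_sup [set (mdist xy.1 xy.2)%:E | xy in [set: M * M]].

End metric_measure_space.
Arguments diameter {R d} M.

(* Only the values of w x on [0, +oo[ are constrained. *)
Record scaling_function {R : realType} {d : measure_display}
    {M : metricMeasurableType d R} (w : M -> R -> R) : Prop := {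
  scaling_ge0 : forall x t, 0 <= t -> 0 <= w x t;
  scaling_continuous : forall x, {within `[0, +oo[, continuous (w x)};
  scaling_increasing : forall x, {in `[0, +oo[ &, {homo w x : s t / s < t}};
  scaling_0 : forall x, w x 0 = 0;
  scaling_growth : exists C1 C2 beta1 beta2 : R,
    [/\ 0 < C1, 0 < C2, 0 < beta1 <= beta2 &
      forall (x y : M) (r rad : R), 0 < r -> r <= rad -> mdist x y <= rad ->
        C1 * (rad / r) `^ beta1 <= w x rad / w y r <= C2 * (rad / r) `^ beta2] }.

Section essential_bounds.
Context {R : realType} {d : measure_display} {M : metricMeasurableType d R}.
Variable mu : {measure set M -> \bar R}.
Implicit Types (D : set M) (f : M -> \bar R).

Definition ess_sup_on D f : \bar R :=
  ereal_inf [set y | \forall x \ae mu, D x -> (f x <= y)%E].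

Definition ess_inf_on D f : \bar R :=
  ereal_sup [set y | \forall x \ae mu, D x -> (y <= f x)%E].

(* Functions are extended by 0 outside D, which changes neither measurability
   on D nor the essential bound of |f|. *)
Definition Linfty_on D : set (M -> R) := [set f | f \_ D \in Lfun mu +oo%E].

Definition Linfty_norm_on D (f : M -> R) : \bar R :=
  ('N[mu]_+oo [EFin \o (f \_ D)])%E.

End essential_bounds.

(* Elements of L^2 are represented by functions M -> R; a domain F is a set of
   functions closed under modification on null sets, and forms on F do not
   depend on the representatives. *)
Section dirichlet_form.
Context {R : realType} {d : measure_display} {M : metricMeasurableType d R}.
Variables (mu : {measure set M -> \bar R}) (F : set (M -> R)).
Implicit Types (E : (M -> R) -> (M -> R) -> R) (u v z : M -> R).

Record symmetric_form E : Prop := {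
  form_sym : forall u v, F u -> F v -> E u v = E v u;
  form_linear : forall (a : R) u v z, F u -> F v -> F z ->
    E (a *: u + v) z = a * E u z + E v z;
  form_ge0 : forall u, F u -> 0 <= E u u;
  form_ae : forall u v z, F u -> F v -> F z ->
    u = v %[ae mu] -> E u z = E v z }.

Definition E1_norm E u : R :=
  Num.sqrt (E u u + (fine ('N[mu]_2%:E [EFin \o u])%E) ^+ 2).

Record dirichlet_form E : Prop := {
  df_L2 : forall u, F u -> u \in Lfun mu 2%:E;
  df_ae : forall u v, F u -> measurable_fun [set: M] v ->
    u = v %[ae mu] -> F v;
  df_lin : forall (a : R) u v, F u -> F v -> F (a *: u + v);
  df_dense : forall u, u \in Lfun mu 2%:E -> forall e : R, 0 < e ->
    exists2 v, F v & ('N[mu]_2%:E [EFin \o (u - v)%R] < e%:E)%E;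
  df_form : symmetric_form E;
  df_closed : forall u_ : nat -> (M -> R), (forall n, F (u_ n)) ->
    (forall e : R, 0 < e -> exists N, forall m n, (N <= m)%N -> (N <= n)%N ->
       E1_norm E (u_ m - u_ n) < e) ->
    exists2 u, F u & E1_norm E (u_ n - u) @[n --> \oo] --> (0 : R);
  df_markov : forall u, F u ->
    let v := fun x => Num.min (Num.max (u x) 0) 1 in F v /\ E v v <= E u u }.

Definition C0 (Omega : set M) : set (M -> R) :=
  [set u | [/\ continuous u, compact (closure [set x | u x != 0]) &
    closure [set x | u x != 0] `<=` Omega]].

Record regular_dirichlet_form E : Prop := {
  rdf_dirichlet : dirichlet_form E;
  rdf_dense_F : forall u, F u -> forall e : R, 0 < e ->
    exists2 v, (F `&` C0 [set: M]) v & E1_norm E (u - v) < e;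
  rdf_dense_C0 : forall u, C0 [set: M] u -> forall e : R, 0 < e ->
    exists2 v, (F `&` C0 [set: M]) v & forall x, `|u x - v x| < e }.

(* Support of an a.e.-class: complement of the largest open set on which u
   vanishes a.e. *)
Definition ess_support u : set M :=
  ~` \bigcup_(U in [set U : set M | open U /\
                     \forall x \ae mu, U x -> u x = 0]) U.

Definition strongly_local E : Prop :=
  forall u v, F u -> F v -> compact (ess_support u) -> compact (ess_support v) ->
    (exists (c : R) (U : set M),
      [/\ open U, ess_support v `<=` U & \forall x \ae mu, U x -> u x = c]) ->
    E u v = 0.

Definition off_diagonal : set (M * M) := [set xy | xy.1 <> xy.2].

(* J(dx,dy) = J(x,dy) mu(dx) is a symmetric Radon measure on M x M \ diag. *)
Record jump_kernel (J : R.-ker M ~> M) : Prop := {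
  jump_radon : forall K : set (M * M), compact K -> K `<=` off_diagonal ->
    (\int[mu]_x J x (xsection K x) < +oo)%E;
  jump_sym : forall S : set (M * M), measurable S -> S `<=` off_diagonal ->
    (\int[mu]_x J x (xsection S x) = \int[mu]_x J x (ysection S x))%E }.

(* The integrand vanishes on the diagonal, so whether the diagonal is removed
   is immaterial. *)
Definition jump_energy (J : R.-ker M ~> M) u : \bar R :=
  (\int[mu]_x \int[J x]_y ((u x - u y) ^+ 2)%:E)%E.

Record no_killing_decomposition E EL EJ (J : R.-ker M ~> M) : Prop := {
  dec_sum : forall u v, F u -> F v -> E u v = EL u v + EJ u v;
  dec_local_form : symmetric_form EL;
  dec_local : strongly_local EL;
  dec_jump_form : symmetric_form EJ;
  dec_jump_kernel : jump_kernel J;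
  dec_jump : forall u, F u -> (EJ u u)%:E = jump_energy J u }.

Definition F' : set (M -> R) :=
  [set u | exists v (a : R), F v /\ u = v + cst a].

(* E(u + a, v + b) := E(u, v). The decompositions are not unique when the
   constants lie in F, but then E(1, v) = 0 as the form has no killing part. *)
Definition ext_form E u v : R :=
  xget 0 [set e | exists u0 v0 (a b : R),
    [/\ F u0, F v0, u = u0 + cst a, v = v0 + cst b & e = E u0 v0]].

Definition F_on E (Omega : set M) : set (M -> R) :=
  [set u | F u /\ forall e : R, 0 < e ->
    exists2 v, (F `&` C0 Omega) v & E1_norm E (u - v) < e].

Definition superharmonic E (Omega : set M) (f u : M -> R) : Prop :=
  F' u /\ forall phi, F_on E Omega phi -> (\forall x \ae mu, 0 <= phi x) ->
    \int[mu]_(x in Omega) (f x * phi x) <= ext_form E u phi.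

Definition tail (J : R.-ker M ~> M) (U Omega : set M) v : \bar R :=
  ess_sup_on mu U (fun x => \int[J x]_(y in ~` Omega) `|v y|%:E)%E.

Definition nonneg_on (D : set M) u : Prop := \forall x \ae mu, D x -> 0 <= u x.

Definition p_mean (p : R) (D : set M) u : R :=
  ((fine (mu D))^-1 * \int[mu]_(x in D) (u x `^ p)) `^ p^-1.

Definition wEH (Rbar : \bar R) (w : M -> R -> R) E (J : R.-ker M ~> M) : Prop :=
  exists p delta sigma CH : R,
    [/\ 0 < p < 1, 0 < delta < 1, 0 < sigma < 1, 1 <= CH &
    forall (x0 : M) (r rad : R), 0 < r -> r <= delta * rad ->
      (rad%:E < sigma%:E * Rbar)%E ->
    forall f u : M -> R, Linfty_on mu (ball x0 rad) f ->
      F' u -> u \in Lfun mu +oo%E ->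
      nonneg_on (ball x0 rad) u -> superharmonic E (ball x0 rad) f u ->
      ((p_mean p (ball x0 r) u)%:E <=
        CH%:E * (ess_inf_on mu (ball x0 r) (EFin \o u) +
          (w x0 r)%:E *
            (tail J (ball x0 (3 / 4 * rad)) (ball x0 rad) (u^\-)%R +
             Linfty_norm_on mu (ball x0 rad) f)))%E].

Definition LG0 (Rbar : \bar R) E : Prop :=
  exists sigma eps0 eta delta : R,
    [/\ 0 < sigma < 1, 0 < eps0 < 1, 0 < eta < 1, 0 < delta < 1 &
    forall (x0 : M) (rad : R), 0 < rad -> (rad%:E < sigma%:E * Rbar)%E ->
    forall u : M -> R, F' u -> u \in Lfun mu +oo%E ->
      superharmonic E (ball x0 rad) (cst 0) u -> nonneg_on [set: M] u ->
    forall a : R, 0 < a ->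
      fine (mu (ball x0 (delta * rad) `&` [set x | u x < a])) /
        fine (mu (ball x0 (delta * rad))) <= eps0 ->
      ((eta * a)%:E <= ess_inf_on mu (ball x0 (delta * rad)) (EFin \o u))%E].

End dirichlet_form.

(* Main.v *)
Require Import Defs.
From mathcomp Require Import all_boot all_order all_algebra.
From mathcomp Require Import all_classical all_reals all_analysis.
From mathcomp Require Import ess_sup_inf measurable_realfun.

Local Open Scope classical_set_scope.
Local Open Scope ring_scope.

(** A superharmonic [u] is [f]-superharmonic with [f = 0], so the weak Harnack
    inequality bounds its [p]-mean over a ball by [CH] times its essential
    infimum there plus two error terms.  The norm of [f] vanishes, and so does
    the tail because [u] is globally non-negative; this leaves
    [p_mean u <= CH * ess_inf u].  On the other hand, if [u >= a] on a fraction
    at least [1 - eps] of the ball, Chebyshev's inequality gives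
    [p_mean u >= (1 - eps) `^ p^-1 * a] (lemma [p_mean_ge]).  With [eps = 1/2]
    the growth lemma holds for [eta = (1/2) `^ p^-1 / CH], the constants
    [delta] and [sigma] being those of the Harnack inequality.

    The vanishing of the tail needs an argument: [u] is non-negative only
    [mu]-almost everywhere, whereas the tail integrates [u^\-] against the
    measures [J x], which could a priori charge [mu]-null sets.  The symmetry of
    the jump measure excludes this for almost every [x]
    (lemma [jump_kernel_null]). *)

Lemma open_metric_ball (R : realFieldType) (T : metricType R) (x : T) (r : R) :
  open (ball x r).
Proof.
rewrite openE => y; rewrite ballEmdist /= => xy; apply/nbhs_ballP.
exists (r - mdist x y); first by rewrite /= subr_gt0.
move=> z; rewrite !ballEmdist /= ltrBrDl; exact/le_lt_trans/metric_triangle.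
Qed.

Section balls.
Context {R : realType} {d : measure_display} {M : metricMeasurableType d R}.
Context {mu : {measure set M -> \bar R}} (hM : metric_measure_space mu).

Lemma measurable_metric_ball (x : M) (r : R) : measurable (ball x r).
Proof.
by rewrite (mms_borel hM); apply: sub_sigma_algebra; exact: open_metric_ball.
Qed.

Lemma measure_ball_gt0 (x : M) (r : R) : 0 < r -> (0 < mu (ball x r))%E.
Proof.
move=> r0; apply: (mms_full_support hM); first exact: open_metric_ball.
by exists x; rewrite ballEmdist /= mdistxx.
Qed.

Lemma measure_ball_lty (x : M) (r : R) : 0 < r -> (mu (ball x r) < +oo)%E.
Proof.
move=> r0; have [K bK [cK clK]] := mms_precompact_ball hM x r0.
have mK : measurable K.
  rewrite -(setCK K); apply: measurableC; rewrite (mms_borel hM).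
  by apply: sub_sigma_algebra; exact: closed_openC.
apply: le_lt_trans (radon_compact (mms_radon hM) cK).
by rewrite le_measure ?inE//; exact: measurable_metric_ball.
Qed.

End balls.

Section tails.
Context {R : realType} {d : measure_display} {M : metricMeasurableType d R}.
Context {mu : {measure set M -> \bar R}} {J : R.-ker M ~> M}.
Context (hJ : jump_kernel mu J).

(** By symmetry, the jump measure of [U `*` N] equals that of [N `*` U], which
    is zero as [N] is null; hence the non-negative function [J x N] has zero
    integral over [U].  Disjointness keeps the rectangle off the diagonal, where
    symmetry is available. *)
Lemma jump_kernel_null (U N : set M) : measurable U -> measurable N ->
  mu N = 0%E -> [disjoint U & N] -> \forall x \ae mu, U x -> J x N = 0%E.
Proof.
move=> mU mN N0 /disj_setPS UN.
have mJ (A : set M) D : measurable A ->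
    @measurable_fun _ _ M (\bar R) D (fun x => J x A).
  by move=> mA; apply: measurable_funS (measurable_kernel J A mA).
apply/(ae_eq_integral_abs mu mU (mJ N U mN)).
transitivity (\int[mu]_x J x (xsection (U `*` N) x))%E.
  rewrite integral_mkcond; apply: eq_integral => x _.
  rewrite patchE; case: ifPn => xU.
    by rewrite in_xsectionX// gee0_abs.
  by rewrite notin_xsectionX// measure0.
rewrite (jump_sym hJ).
- transitivity (\int[mu]_(x in N) `|J x U|)%E.
    rewrite [RHS]integral_mkcond; apply: eq_integral => x _.
    rewrite patchE; case: ifPn => xN.
      by rewrite in_ysectionX// gee0_abs.
    by rewrite notin_ysectionX// measure0.
  by apply: integral_abs_eq0 => //; exact: mJ.
- exact: measurableX.
- by move=> [x y] /= [Ux Ny] xy; apply: (UN x); split=> //; rewrite [x]xy.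
Qed.

(** The null set where [u] is negative is not charged by [J x] outside [Omega]
    for almost every [x] in [U], so [0] is an essential upper bound of the inner
    integrals.  Equality fails when [U] is null: the essential supremum is then
    [-oo]. *)
Lemma tail_funrneg_le0 (U Omega : set M) (u : M -> R) : measurable Omega ->
  U `<=` Omega -> measurable_fun [set: M] u -> nonneg_on mu [set: M] u ->
  (tail mu J U Omega (u^\-)%R <= 0)%E.
Proof.
move=> mO UO mfu [N [mN N0 uN]]; apply: ereal_inf_lbound => /=.
have mNO : measurable (N `\` Omega) by exact: measurableD.
have NO0 : mu (N `\` Omega) = 0%E by apply: subset_measure0 N0 => //; exact: subDsetl.
have dis : [disjoint Omega & N `\` Omega] by apply/disj_setPS => x [? []].
apply: filterS (jump_kernel_null _ _ mO mNO NO0 dis) => x Jx0 /UO /Jx0 {}Jx0.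
rewrite le_eqVlt; apply/orP; left; apply/eqP.
under eq_integral do rewrite -abse_EFin.
apply/(ae_eq_integral_abs _ (measurableC mO)).
  by apply/measurable_EFinP; apply: measurable_funS (measurable_funrneg mfu).
exists (N `\` Omega); split=> // y /= /not_implyP[nOy ney].
split=> //; apply: uN => /= /(_ I) uy0; apply: ney.
by rewrite /= /funrneg max_r// oppr_le0.
Qed.

End tails.

Section lower_bound.
Context {R : realType} {d : measure_display} {M : metricMeasurableType d R}.
Context {mu : {measure set M -> \bar R}}.

Lemma ae_bounded_Lfun (u : M -> R) : (0 < mu [set: M])%E ->
  u \in Lfun mu +oo%E -> exists2 K : R, 0 <= K & \forall x \ae mu, `|u x| <= K.
Proof.
move=> mu0 /sub_Lfun_finLfun; rewrite inE /= /finite_norm unlock /Lnorm mu0.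
set s := ess_sup _ _ => soo.
exists (Num.max 0 (fine s)); first by rewrite le_max lexx.
apply: filterS (ess_sup_ge mu (abse \o (EFin \o u))) => x /=.
rewrite -/s; case: s soo => [r| |]//= _; rewrite lee_fin => ur.
by rewrite le_max ur orbT.
Qed.

(** Chebyshev's inequality: [u `^ p] is at least [a `^ p] on the part of [D]
    where [u >= a], which has measure at least [(1 - eps) * mu D].  Essential
    boundedness makes the integral of [u `^ p] finite; an infinite one would
    count as [0] in [p_mean]. *)
Lemma p_mean_ge (p : R) (D : set M) (u : M -> R) (a eps : R) : 0 < p ->
  measurable D -> (0 < mu D < +oo)%E -> u \in Lfun mu +oo%E ->
  nonneg_on mu D u -> 0 <= a -> eps <= 1 ->
  fine (mu (D `&` [set x | u x < a])) / fine (mu D) <= eps ->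
  (1 - eps) `^ p^-1 * a <= p_mean mu p D u.
Proof.
move=> p0 mD /andP[D0 Doo] uL u0 a0 eps1.
have mfu : measurable_fun [set: M] u by have := sub_Lfun_mfun uL; rewrite inE.
have mA : measurable (D `&` [set x | u x < a]).
  apply: measurableI => //.
  rewrite (_ : [set x | _] = [set: M] `&` u @^-1` `]-oo, a[%classic).
    by apply: mfu => //; exact: measurable_itv.
  by rewrite setTI; apply/seteqP; split=> x; rewrite /= in_itv.
set A := D `&` _ in mA *.
have Afin : mu A \is a fin_num.
  rewrite ge0_fin_numE//; apply: le_lt_trans Doo.
  by rewrite le_measure ?inE//; exact: subIsetl.
have Dfin : mu D \is a fin_num by rewrite ge0_fin_numE.
have D0' : 0 < fine (mu D) by rewrite fine_gt0// D0.
rewrite ler_pdivrMr// => Aeps.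
have mg : measurable_fun D (fun x => (u x `^ p)%:E).
  apply/measurable_EFinP; apply: measurable_funS (_ : measurable_fun [set: M] _) => //.
  exact: (measurableT_comp (measurable_powR p)).
have mDA : measurable (D `\` A) by exact: measurableD.
have big : ((a `^ p)%:E * mu (D `\` A) <= \int[mu]_(x in D) (u x `^ p)%:E)%E.
  rewrite -integral_cst//.
  apply: (@le_trans _ _ (\int[mu]_(x in D `\` A) (u x `^ p)%:E)%E).
    apply: ge0_le_integral => //.
    - by move=> x _; rewrite lee_fin powR_ge0.
    - by apply: measurable_funS mg => //; exact: subDsetl.
    - move=> x [Dx nA]; rewrite lee_fin ge0_ler_powR ?(ltW p0)//= ?nnegrE//.
        rewrite leNgt; apply/negP => ux0; apply: nA; split=> //=.
        exact: lt_le_trans ux0 a0.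
      by rewrite leNgt; apply/negP => ua; exact: nA.
  apply: ge0_subset_integral => //.
  by move=> x _; rewrite lee_fin powR_ge0.
have [K K0 uK] : exists2 K : R, 0 <= K & \forall x \ae mu, `|u x| <= K.
  apply: ae_bounded_Lfun => //; apply: (lt_le_trans D0).
  by rewrite le_measure ?inE.
(* The power of a negative number is not controlled by its absolute value, so
   both the bound and the non-negativity of [u] enter, almost everywhere. *)
have fin : (\int[mu]_(x in D) (u x `^ p)%:E)%E \is a fin_num.
  rewrite ge0_fin_numE; last by apply: integral_ge0 => x _; rewrite lee_fin powR_ge0.
  apply: (@le_lt_trans _ _ (\int[mu]_(x in D) cst (K `^ p)%:E x)%E).
    apply: ae_ge0_le_integral => //.
    - by move=> x _; rewrite lee_fin powR_ge0.
    - by move=> x _; rewrite lee_fin powR_ge0.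
    - apply: filterS2 u0 uK => x u0 uK Dx; rewrite lee_fin.
      rewrite ge0_ler_powR ?(ltW p0)// ?nnegrE ?u0//.
      exact: le_trans (ler_norm _) uK.
  by rewrite integral_cst// lte_mul_pinfty// lee_fin powR_ge0.
(* The constant is moved inside the outer power to compare the bases. *)
have aE : (1 - eps) `^ p^-1 * a = ((1 - eps) * a `^ p) `^ p^-1.
  by rewrite powRM ?subr_ge0 ?powR_ge0// -powRrM divff ?gt_eqF// powRr1.
rewrite aE /p_mean; apply: ge0_ler_powR.
- by rewrite invr_ge0 ltW.
- by rewrite nnegrE mulr_ge0 ?powR_ge0// subr_ge0.
- rewrite nnegrE mulr_ge0 ?invr_ge0 ?(ltW D0')//.
  by apply: fine_ge0; apply: integral_ge0 => x _; rewrite lee_fin powR_ge0.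
rewrite ler_pdivlMl// mulrA /Rintegral -lee_fin fineK//.
have muDA : mu (D `\` A) = (fine (mu D) - fine (mu A))%:E.
  by rewrite measureD// setIidr ?EFinB ?fineK//; exact: subIsetl.
apply: le_trans big; rewrite muDA -EFinM lee_fin mulrC.
rewrite ler_wpM2l ?powR_ge0// mulrBr mulr1 lerB// mulrC.
exact: Aeps.
Qed.

End lower_bound.

Theorem lemma6p4 (R : realType) (d : measure_display)
    (M : metricMeasurableType d R) (mu : {measure set M -> \bar R})
    (hM : metric_measure_space mu)
    (Rbar : \bar R) (hRbar : (0 < Rbar <= diameter M)%E)
    (w : M -> R -> R) (hw : scaling_function w)
    (F : set (M -> R)) (E EL EJ : (M -> R) -> (M -> R) -> R)
    (J : R.-ker M ~> M)
    (hE : regular_dirichlet_form mu F E)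
    (hdec : no_killing_decomposition mu F E EL EJ J) :
  wEH mu F Rbar w E J -> LG0 mu F Rbar E.
Proof.
move=> [p [delta [sigma [CH [/andP[p0 p1] hdelta hsigma CH1 wH]]]]].
have CH0 : 0 < CH by exact: lt_le_trans ltr01 CH1.
have q0 : 0 < (1 - 2^-1 : R) `^ p^-1.
  by rewrite powR_gt0// subr_gt0 invf_lt1// ltr1n.
have q1 : (1 - 2^-1 : R) `^ p^-1 < 1.
  rewrite [ltRHS](_ : 1 = 1 `^ p^-1); last by rewrite powR1.
  rewrite gt0_ltr_powR ?invr_gt0// ?nnegrE//.
  by rewrite subr_ge0 invf_le1// ler1n.
exists sigma, 2^-1, (CH^-1 * (1 - 2^-1) `^ p^-1), delta; split=> //.
- by rewrite invr_gt0 invf_lt1//= ltr0n ltr1n.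
- rewrite mulr_gt0 ?invr_gt0//=.
  by rewrite mulrC ltr_pdivrMr// mul1r (lt_le_trans q1).
move=> x0 rad rad0 radR u F'u uL u_super u0 a a0 small.
have r0 : 0 < delta * rad by rewrite mulr_gt0//; case/andP: hdelta.
have restr0 D : (cst 0 : M -> R) \_ D = cst 0.
  by apply/funext => x; rewrite patchE; case: ifP.
have mfu : measurable_fun [set: M] u by have := sub_Lfun_mfun uL; rewrite inE.
have mean : ((p_mean mu p (ball x0 (delta * rad)) u)%:E <=
    CH%:E * ess_inf_on mu (ball x0 (delta * rad)) (EFin \o u))%E.
  apply: le_trans (wH x0 _ rad r0 (lexx _) radR (cst 0) u _ F'u uL _ u_super) _.
  - rewrite /Linfty_on /= restr0.
    apply/andP; split; rewrite inE /=; first exact: measurable_cst.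
    by rewrite /finite_norm Lnorm0.
  - by apply: filterS u0 => x ux _; exact: ux.
  (* Once the essential infimum is cancelled, it remains to bound the error term
     above by zero: a non-negative weight times a non-positive sum. *)
  rewrite lee_pmul2l// -[leRHS]adde0 leeD2l//.
  rewrite mule_ge0_le0//.
    by rewrite lee_fin (scaling_ge0 hw)// ltW.
  rewrite /Linfty_norm_on restr0 Lnorm0// adde0.
  apply: (tail_funrneg_le0 (dec_jump_kernel hdec)) => //.
    exact: (measurable_metric_ball hM).
  by apply: le_ball; rewrite ler_piMl ?ltW// ltr_pdivrMr// mul1r ltr_nat.
rewrite -mulrA EFinM lee_pdivrMl//; apply: le_trans mean; rewrite lee_fin.
apply: p_mean_ge => //.
- exact: (measurable_metric_ball hM).
- by rewrite (measure_ball_gt0 hM)// (measure_ball_lty hM).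
- by apply: filterS u0 => x ux _; exact: ux.
- exact: ltW.
- by rewrite invf_le1// ler1n.
Qed.
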